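(* Let $R$ be an abelian ring, and let $n$ be a positive integer. Then the following are equivalent: (1) $M_n(R)$ is nil-clean. (2) $R/J(R)$ is Boolean and $M_n(J(R))$ is nil.
   Context: All rings are associative with an identity, not necessarily commutative. A ring $R$ is abelian if every idempotent of $R$ is central. An element $a$ of a ring $S$ is nil-clean if there is an idempotent $e\in S$ such that $a-e$ is nilpotent; the ring $S$ is nil-clean if every element of $S$ is nil-clean. $M_n(R)$ is the ring of all $n\times n$ matrices over $R$. $J(R)$ is the Jacobson radical of $R$, and $M_n(J(R))$ is the ideal of $M_n(R)$ consisting of the matrices with all entries in $J(R)$; it is nil if each of its elements is nilpotent. A ring is Boolean if each of its elements is idempotent. *)

(* Defs.v *)
From HB Require Import structures.
From mathcomp Require Import all_boot all_algebra.
From mathcomp Require Import boolp classical_sets.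

Set Implicit Arguments.
Unset Strict Implicit.
Unset Printing Implicit Defensive.

Import GRing.Theory.

Local Open Scope classical_set_scope.
Local Open Scope ring_scope.
Local Open Scope quotient_scope.

(* Rings are [pzRingType]s: associative and unital, with the zero ring
   allowed. *)

Definition idempotent_elt (S : pzRingType) (e : S) : Prop := e * e = e.

Definition nilpotent_elt (S : pzRingType) (a : S) : Prop :=
  exists k : nat, a ^+ k = 0.

Definition abelian_ring (R : pzRingType) : Prop :=
  forall e : R, idempotent_elt e -> forall x : R, e * x = x * e.

Definition nil_clean_elt (S : pzRingType) (a : S) : Prop :=
  exists e : S, idempotent_elt e /\ nilpotent_elt (a - e).

Definition nil_clean_ring (S : pzRingType) : Prop :=
  forall a : S, nil_clean_elt a.

Definition boolean_ring (S : pzRingType) : Prop :=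
  forall a : S, idempotent_elt a.

Definition nil_subset (S : pzRingType) (I : {pred S}) : Prop :=
  forall a : S, a \in I -> nilpotent_elt a.

Definition left_ideal (R : pzRingType) (I : set R) : Prop :=
  [/\ I 0, forall x y, I x -> I y -> I (x + y) & forall a x, I x -> I (a * x)].

Definition maximal_left_ideal (R : pzRingType) (M : set R) : Prop :=
  [/\ left_ideal M, M != setT &
      forall I : set R, left_ideal I -> M `<=` I -> I != setT -> I = M].

(* A boolean predicate, as required by [mxOver] and by the quotient
   construction of [ring_quotient]. For the zero ring there is no maximal
   left ideal and [jacobson R] is the whole ring. *)
Definition jacobson (R : pzRingType) : {pred R} :=
  fun x : R => `[< forall M : set R, maximal_left_ideal M -> M x >].
Arguments jacobson : clear implicits.

Section Jacobson.
Variable R : pzRingType.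

Lemma jacobsonP (x : R) :
  reflect (forall M : set R, maximal_left_ideal M -> M x) (x \in jacobson R).
Proof. exact: asboolP. Qed.

Lemma left_idealN (I : set R) x : left_ideal I -> I x -> I (- x).
Proof. by move=> [_ _ IM] Ix; rewrite -mulN1r; apply: IM. Qed.

Lemma left_ideal1 (I : set R) : left_ideal I -> I != setT -> ~ I 1.
Proof.
move=> [_ _ IM] /eqP nI I1; apply: nI; rewrite -subTset => x _.
by rewrite -[x]mulr1; apply: IM.
Qed.

(* For [M] maximal, the transporter [{x | x r \in M}] is a maximal left ideal
   unless [r \in M]; this gives stability of [jacobson R] on the right. *)
Lemma maximal_left_ideal_transporter (M : set R) (r : R) :
  maximal_left_ideal M -> ~ M r -> maximal_left_ideal [set x | M (x * r)].
Proof.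
move=> [[M0 MD MM] MT Mmax] Mr.
have Ml : left_ideal M by [].
split.
- split=> [|x y Mx My|a x Mx] /=; first by rewrite mul0r.
  + by rewrite mulrDl; apply: MD.
  + by rewrite -mulrA; apply: MM.
- apply/eqP => NT; apply: Mr.
  have : [set x | M (x * r)] 1 by rewrite NT.
  by rewrite /= mul1r.
move=> I Il sNI IT; apply/seteqP; split=> // x Ix /=.
have [I0 ID IM] := Il.
apply: contrapT => Mxr; apply: (left_ideal1 Il IT).
pose K := [set y : R | exists m i, [/\ M m, I i & y = m + i * r]].
have Kl : left_ideal K.
  split.
  - by exists 0, 0; rewrite mul0r addr0.
  - move=> _ _ [m [i [Mm Ii ->]]] [m' [i' [Mm' Ii' ->]]].
    by exists (m + m'), (i + i'); split; [exact: MD|exact: ID|rewrite mulrDl addrACA].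
  - move=> a _ [m [i [Mm Ii ->]]]; exists (a * m), (a * i).
    by split; [exact: MM|exact: IM|rewrite mulrDr mulrA].
have sMK : M `<=` K.
  by move=> m Mm; exists m, 0; split; rewrite ?mul0r ?addr0.
have [KT|/eqP KT] := pselect (K = setT); last first.
  have KM := Mmax K Kl sMK KT; case: Mxr; rewrite -KM.
  by exists 0, x; rewrite add0r.
have : K r by rewrite KT.
move=> [m [i [Mm Ii rE]]].
rewrite -(subrK i 1); apply: ID => //; apply: sNI => /=.
suff -> : (1 - i) * r = m by [].
by rewrite mulrBl mul1r [X in X - _]rE addrK.
Qed.

Lemma jacobson_zmod_closed : zmod_closed (jacobson R).
Proof.
split=> [|x y /jacobsonP Jx /jacobsonP Jy]; apply/jacobsonP => M Mm.
  by case: Mm => -[].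
have [Ml _ _] := Mm; have [_ MD _] := Ml.
by apply: MD; [exact: Jx|apply: left_idealN => //; exact: Jy].
Qed.

Lemma jacobsonMl (a x : R) : x \in jacobson R -> a * x \in jacobson R.
Proof.
move=> /jacobsonP Jx; apply/jacobsonP => M Mm.
by have [[_ _ MM] _ _] := Mm; apply: MM; exact: Jx.
Qed.

Lemma jacobsonMr (a x : R) : x \in jacobson R -> x * a \in jacobson R.
Proof.
move=> /jacobsonP Jx; apply/jacobsonP => M Mm.
have [Ma|Ma] := pselect (M a); first by have [[_ _ MM] _ _] := Mm; exact: MM.
exact: Jx _ (maximal_left_ideal_transporter Mm Ma).
Qed.

HB.instance Definition _ :=
  GRing.isZmodClosed.Build R (jacobson R) jacobson_zmod_closed.

(* The library only puts a ring structure on [{ideal_quot I}] for commutative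
   rings and proper [I], so the one on R / J(R) is built here. *)
Definition jacobson_quot : Type := {ideal_quot jacobson R}.

HB.instance Definition _ := GRing.Zmodule.on jacobson_quot.
HB.instance Definition _ := EqQuotient.on jacobson_quot.

Definition jacobson_proj (x : R) : jacobson_quot := \pi_jacobson_quot x.

Lemma jacobson_proj_eq (x y : R) :
  (jacobson_proj x == jacobson_proj y) = (x - y \in jacobson R).
Proof. exact/esym/Quotient.idealrBE. Qed.

Lemma jacobson_proj_surj (q : jacobson_quot) : exists x, q = jacobson_proj x.
Proof. by exists (repr q); rewrite /jacobson_proj reprK. Qed.

Definition jacobson_quot_mul (p q : jacobson_quot) : jacobson_quot :=
  jacobson_proj (repr p * repr q).

Local Notation mulq := jacobson_quot_mul.

Let repr_proj (x : R) : repr (jacobson_proj x) - x \in jacobson R.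
Proof. by rewrite -jacobson_proj_eq /jacobson_proj reprK. Qed.

Let projM (x y : R) :
  mulq (jacobson_proj x) (jacobson_proj y) = jacobson_proj (x * y).
Proof.
apply/eqP; rewrite jacobson_proj_eq.
set x' := repr _; set y' := repr _.
have -> : x' * y' - x * y = (x' - x) * y' + x * (y' - y).
  by rewrite mulrBl mulrBr addrA subrK.
by apply: rpredD; [apply: jacobsonMr|apply: jacobsonMl]; exact: repr_proj.
Qed.

Let projD (x y : R) :
  jacobson_proj x + jacobson_proj y = jacobson_proj (x + y).
Proof. exact/esym/Quotient.pi_add. Qed.

Let mulqA : associative mulq.
Proof.
move=> p q r; have [x ->] := jacobson_proj_surj p.
have [y ->] := jacobson_proj_surj q; have [z ->] := jacobson_proj_surj r.
by rewrite !projM mulrA.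
Qed.

Let mul1q : left_id (jacobson_proj 1) mulq.
Proof. by move=> p; have [x ->] := jacobson_proj_surj p; rewrite projM mul1r. Qed.

Let mulq1 : right_id (jacobson_proj 1) mulq.
Proof. by move=> p; have [x ->] := jacobson_proj_surj p; rewrite projM mulr1. Qed.

Let mulqDl : left_distributive mulq +%R.
Proof.
move=> p q r; have [x ->] := jacobson_proj_surj p.
have [y ->] := jacobson_proj_surj q; have [z ->] := jacobson_proj_surj r.
by rewrite projD !projM projD mulrDl.
Qed.

Let mulqDr : right_distributive mulq +%R.
Proof.
move=> p q r; have [x ->] := jacobson_proj_surj p.
have [y ->] := jacobson_proj_surj q; have [z ->] := jacobson_proj_surj r.
by rewrite projD !projM projD mulrDr.
Qed.

HB.instance Definition _ := GRing.Zmodule_isPzRing.Build jacobson_quot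
  mulqA mul1q mulq1 mulqDl mulqDr.

Lemma jacobson_proj_zmod_morphism : zmod_morphism jacobson_proj.
Proof. by move=> x y; apply/(canRL (addrK _)); rewrite projD subrK. Qed.

Lemma jacobson_proj_monoid_morphism : monoid_morphism jacobson_proj.
Proof. by split=> // x y; exact/esym/projM. Qed.

HB.instance Definition _ :=
  GRing.isZmodMorphism.Build R jacobson_quot jacobson_proj
    jacobson_proj_zmod_morphism.
HB.instance Definition _ :=
  GRing.isMonoidMorphism.Build R jacobson_quot jacobson_proj
    jacobson_proj_monoid_morphism.

Lemma jacobson_proj_eq0 (x : R) : (jacobson_proj x == 0) = (x \in jacobson R).
Proof. by rewrite -(raddf0 jacobson_proj) jacobson_proj_eq subr0. Qed.

End Jacobson.
Arguments jacobson_quot : clear implicits.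

(* Main.v *)
(* (1) => (2): nil-clean rings are exchange, and this passes to the corner R; for
   an abelian exchange ring every maximal left ideal M is a completely prime
   two-sided ideal. Decomposing the matrix a E_11 as idempotent plus nilpotent
   and reducing modulo M then forces a = 0 or a = 1 in R / M, so R / J(R) is
   Boolean. A matrix E + N over J(R) has 1 - E invertible, so E = 0.

   (2) => (1): over the field with two elements, induction on the size splits
   off invariant subspaces, and a matrix without invariant subspaces is cyclic,
   hence similar to a shift plus an explicit idempotent. A Boolean ring is split by
   idempotents until all entries are 0 or 1. Finally idempotents lift modulo the
   nil ideal M_n(J(R)). *)
Require Import Defs.
From HB Require Import structures.
From mathcomp Require Import all_boot all_algebra.
From mathcomp Require Import boolp classical_sets.

Set Implicit Arguments.
Unset Strict Implicit.
Unset Printing Implicit Defensive.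

Import GRing.Theory.

Local Open Scope ring_scope.

(** * Exchange and maximal left ideals *)

Lemma nilpotent_add1_unit (S : pzRingType) (b : S) :
  nilpotent_elt b -> exists v, (1 + b) * v = 1 /\ v * (1 + b) = 1.
Proof.
move=> [k bk]; exists (\sum_(i < k) (- b) ^+ i).
have bk' : (- b) ^+ k = 0 by rewrite exprNn bk mulr0.
have rE : (1 + b) * (\sum_(i < k) (- b) ^+ i) = 1.
  have := subrX1 (- b) k; rewrite bk' sub0r => /(congr1 -%R).
  by rewrite opprK -mulNr opprD !opprK [b + 1]addrC => <-.
split=> //; rewrite -[RHS]rE; apply/commr_sym; apply: commr_sum => i _;
  apply: commrX; apply: commrN.
by apply: commr_sym; apply: commrD; [exact: commr1|].
Qed.

(* Nicholson's computation: if [a = f + u] with [f] idempotent and [u] a unit,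
   then [e = u^-1 (1 - f) u] satisfies [u (e - a) = a - a^2]. *)
Lemma nil_clean_exchange (S : pzRingType) (a : S) : nil_clean_elt (a - 1) ->
  exists e s t, [/\ idempotent_elt e, e = s * a & 1 - e = t * (1 - a)].
Proof.
(* Here [u] is [1 + (a - 1 - f)], that is [a - f]; this is why nil-cleanness is asked of [a - 1]. *)
move=> [f [ff /nilpotent_add1_unit [v]]]; set u := 1 + _ => -[uv vu].
have aE : a = f + u by rewrite [f + _]addrC -addrA subrK addrC subrK.
clearbody u.
have aaE : a - a * a = u - f * u - u * (f + u).
  have -> : a * a = f + f * u + u * (f + u).
    by rewrite aE mulrDl mulrDr ff.
  by rewrite {1}aE !opprD !addrA [f + u]addrC addrK.
have eE : v * (1 - f) * u = a + v * (a - a * a).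
  rewrite aaE -aE [in RHS]mulrBr (mulrA v u a) vu mul1r [RHS]addrC subrK.
  by rewrite -mulrA mulrBl mul1r.
exists (v * (1 - f) * u), (1 + v * (1 - a)), (1 - v * a); split.
- rewrite /idempotent_elt mulrA -[_ * u * _]mulrA [u * _]mulrA uv mul1r.
  rewrite -[v * _ * _]mulrA; congr (v * _ * u).
  by rewrite mulrBl mul1r mulrBr mulr1 ff subrr subr0.
- by rewrite eE mulrDl mul1r -mulrA mulrBl mul1r.
- by rewrite eE mulrBl mul1r -mulrA [a * (1 - a)]mulrBr mulr1 opprD addrA.
Qed.

Definition corner_mx (S : pzRingType) n (a : S) : 'M[S]_n.+1 :=
  a *: delta_mx 0 0.

Lemma corner_mxE (S : pzRingType) n (a : S) i j :
  corner_mx n a i j = if (i == 0) && (j == 0) then a else 0.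
Proof. by rewrite !mxE; case: ifP; rewrite ?mulr1 ?mulr0. Qed.

Lemma mul_corner_mx (S : pzRingType) n (a : S) (A : 'M_n.+1) i j :
  (A * corner_mx n a) i j = if j == 0 then A i 0 * a else 0.
Proof.
rewrite mxE (bigD1 0) //= big1 ?addr0 => [|k /negPf k0].
  by rewrite corner_mxE eqxx /=; case: ifP => _ //; rewrite mulr0.
by rewrite corner_mxE k0 mulr0.
Qed.

(** The idempotent [E] is a left multiple of [corner_mx n x], so it vanishes outside its first
    column. Hence its entry at (0, 0) is idempotent, and the exchange identities can be read off
    there. *)
Lemma corner_exchange (S : pzRingType) n : nil_clean_ring 'M[S]_n.+1 ->
  forall x : S, exists e s t,
    [/\ idempotent_elt e, e = s * x & 1 - e = t * (1 - x)].
Proof.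
move=> nc x; have [E [P [Q [EE EP EQ]]]] :=
  nil_clean_exchange (nc (corner_mx n x - 1)).
have E0 k l : l != 0 -> E k l = 0 by rewrite EP mul_corner_mx => /negPf ->.
exists (E 0 0), (P 0 0), (Q 0 0); split.
- rewrite /idempotent_elt -[in RHS]EE [in RHS]mxE (bigD1 0) //= big1 ?addr0 //.
  by move=> k k0; rewrite (E0 0 k k0) mul0r.
- by rewrite [in LHS]EP mul_corner_mx.
- have subE (X Y : 'M[S]_n.+1) : (X - Y) 0 0 = X 0 0 - Y 0 0 by rewrite !mxE.
  have := congr1 (fun A : 'M_n.+1 => A 0 0) EQ.
  by rewrite mulrBr mulr1 !subE mul_corner_mx [(1 : 'M_n.+1) 0 0]mxE mulrBr mulr1.
Qed.

(** With [e = u v], the element [g = v e u] is a central idempotent and [u g v = e]; hence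
    [e = g u v = v e u e = v e u]. *)
Lemma idempotent_swap (S : pzRingType) (u v : S) : abelian_ring S ->
  idempotent_elt (u * v) -> u * v = v * (u * v) * u.
Proof.
move=> ab; move uvE: (u * v) => e ee.
have uvK x : u * (v * x) = e * x by rewrite mulrA uvE.
have eK x : e * (e * x) = e * x by rewrite mulrA ee.
have gg : idempotent_elt (v * e * u).
  by rewrite /idempotent_elt -!mulrA uvK !eK.
have uge : u * (v * e * u) * v = e by rewrite -!mulrA uvE uvK ee ee.
by rewrite -[LHS]uge -(ab _ gg) -!mulrA uvE -(ab _ ee u) eK.
Qed.

Section MaximalLeftIdeal.
Variables (S : pzRingType) (M : set S).
Hypotheses (ab : abelian_ring S) (maxM : maximal_left_ideal M).
Hypothesis exch : forall x : S, exists e s t,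
  [/\ idempotent_elt e, e = s * x & 1 - e = t * (1 - x)].

Lemma maximal_left_ideal1 : ~ M 1.
Proof. by case: maxM => Ml Mt _; apply: left_ideal1. Qed.

Lemma maximal_left_ideal_inv (x : S) : ~ M x -> exists r, M (1 - r * x).
Proof.
move=> Mx; have [Ml _ Mmax] := maxM; have [M0 MD MM] := Ml.
pose K := [set y : S | exists m r, M m /\ y = m + r * x]%classic.
have Kl : left_ideal K.
  split; first by exists 0, 0; rewrite mul0r addr0.
    move=> _ _ [m [r [Mm ->]]] [m' [r' [Mm' ->]]]; exists (m + m'), (r + r').
    by rewrite mulrDl addrACA; split=> //; apply: MD.
  move=> a _ [m [r [Mm ->]]]; exists (a * m), (a * r).
  by rewrite mulrDr mulrA; split=> //; apply: MM.
have sMK : (M `<=` K)%classic.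
  by move=> m Mm; exists m, 0; rewrite mul0r addr0.
have [KT|KT] := eqVneq K setT.
  have [m [r [Mm e1]]] : K 1 by rewrite KT.
  by exists r; rewrite e1 addrK.
by case: Mx; rewrite -(Mmax K Kl sMK KT); exists 0, 1; rewrite mul1r add0r.
Qed.

Lemma maximal_left_ideal_idem (x : S) : ~ M x ->
  exists s, idempotent_elt (s * x) /\ M (1 - s * x).
Proof.
move=> /maximal_left_ideal_inv [r Mr].
have [[_ _ MM] _ _] := maxM.
have [e [s [t [ee eE e1E]]]] := exch (r * x).
by exists (s * r); rewrite -mulrA -eE e1E; split=> //; apply: MM.
Qed.

(** If [m r] is outside [M], some idempotent [s m r] is congruent to 1 modulo [M]. By
    [idempotent_swap] it is a left multiple of [s m], which lies in [M], so [M] would contain 1. *)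
Lemma maximal_left_ideal_mulr (m r : S) : M m -> M (m * r).
Proof.
move=> Mm; apply: contrapT => /maximal_left_ideal_idem [s].
have [[_ MD MM] _ _] := maxM.
rewrite mulrA => -[ee Me]; apply: maximal_left_ideal1.
rewrite -[1](subrK (s * m * r)); apply: MD => //.
by rewrite (idempotent_swap ab ee); apply/MM/MM.
Qed.

(** If [x] is outside [M], it has a left inverse [s] modulo [M], and [y = (1 - s x) y + s (x y)]. *)
Lemma maximal_left_ideal_prime (x y : S) : M (x * y) -> M x \/ M y.
Proof.
move=> Mxy; have [Mx|/maximal_left_ideal_idem [s [_ Ms]]] := pselect (M x).
  by left.
have [[_ MD MM] _ _] := maxM.
right; rewrite -[y]mul1r -[1](subrK (s * x)) mulrDl; apply: MD.
  exact: maximal_left_ideal_mulr.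
by rewrite -mulrA; apply: MM.
Qed.

End MaximalLeftIdeal.

(** * Nilpotent matrices modulo a completely prime ideal *)

Definition completely_prime_ideal (S : pzRingType) (P : set S) : Prop :=
  [/\ left_ideal P, forall x a, P x -> P (x * a), ~ P 1
    & forall x y, P (x * y) -> P x \/ P y].

Lemma mulmx2E (S : pzRingType) m n (A : 'M[S]_(m, 2)) (B : 'M_(2, n)) i j :
  (A *m B) i j = A i 0 * B 0 j + A i 1 * B 1 j.
Proof.
rewrite mxE !big_ord_recl big_ord0 addr0.
by congr (_ + A i _ * B _ j); apply: val_inj.
Qed.

Section NilpotentModPrime.
Variables (S : pzRingType) (P : set S).
Hypothesis primeP : completely_prime_ideal P.

Let P0 : P 0. Proof. by case: primeP => -[]. Qed.
Let PD x y : P x -> P y -> P (x + y).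
Proof. by case: primeP => -[_ PD _] _ _ _; exact: PD. Qed.
Let PMl a x : P x -> P (a * x).
Proof. by case: primeP => -[_ _ PM] _ _ _; exact: PM. Qed.
Let PMr x a : P x -> P (x * a).
Proof. by case: primeP => _ PM _ _; exact: PM. Qed.
Let PN x : P x -> P (- x).
Proof. by case: primeP => Pl _ _ _; exact: left_idealN. Qed.
Let PB x y : P x -> P y -> P (x - y).
Proof. by move=> Px Py; apply: PD => //; exact: PN. Qed.
Let P1 : ~ P 1. Proof. by case: primeP. Qed.
Let PM x y : P (x * y) -> P x \/ P y.
Proof. by case: primeP => _ _ _; apply. Qed.

Lemma completely_prime_exp x k : P (x ^+ k) -> P x.
Proof. by elim: k => [/P1//|k IH]; rewrite exprS => /PM[|/IH]. Qed.

Lemma nilpotent_mx2_mod_prime (T : 'M[S]_2) : nilpotent_elt T ->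
  P (T 0 1) \/ P (1 + T 1 1) -> P (T 0 0) \/ P (1 - T 0 0).
Proof.
set a := T 0 0; set b := T 0 1; set c := T 1 0; set d := T 1 1.
move=> [n Tn] [Pb|Pd].
  (* Modulo [P] the matrix is lower triangular, so its powers have corner [a ^+ k]. *)
  left; suff [_] : P ((T ^+ n) 0 1) /\ P ((T ^+ n) 0 0 - a ^+ n).
    by rewrite Tn mxE sub0r => /PN; rewrite opprK => /completely_prime_exp.
  elim: (n) => [|k [IH1 IH0]]; first by rewrite !expr0 !mxE /= subrr.
  rewrite !exprSr -!mulmxE !mulmx2E; split; first by apply: PD;
    [exact: PMl|exact: PMr].
  by rewrite addrAC -mulrBl; apply: PD; exact: PMr.
(* Now [d] is -1 modulo [P]. A row [(y1, y2)] killed by [T] has [y2 = y1 b] and [y1 (a + b c) = 0].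
   If [a + b c] were outside [P], then [T] would act injectively on rows modulo [P] and could not be
   nilpotent. *)
have Pz : P (a + b * c).
  apply: contrapT => Nz; suff : ~ (P ((T ^+ n) 0 0) /\ P ((T ^+ n) 0 1)).
    by apply; rewrite Tn !mxE.
  elim: (n) => [|k IH]; first by rewrite !expr0 !mxE /= => -[/P1].
  rewrite exprSr -!mulmxE !mulmx2E => -[]; rewrite -/a -/b -/c -/d.
  move: (_ 0 0) (_ 0 1) IH => y1 y2 IH Pa Pb; apply: IH.
  have Py : P (y1 * b - y2).
    suff -> : y1 * b - y2 = y1 * b + y2 * d - y2 * (1 + d).
      by apply: PB => //; exact: PMl.
    by rewrite mulrDr mulr1 [y2 + _]addrC opprD addrA addrK.
  have Py1 : P y1.
    suff /PM[] : P (y1 * (a + b * c)) by [].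
    suff -> : y1 * (a + b * c) = y1 * a + y2 * c + (y1 * b - y2) * c.
      by apply: PD => //; exact: PMr.
    by rewrite mulrBl mulrDr mulrA [y1 * b * c - _]addrC addrA addrK.
  split=> //; suff -> : y2 = y1 * b - (y1 * b - y2) by apply: PB => //; exact: PMr.
  by rewrite subKr.
(* Modulo [P], [T] is now the column [(b, -1)] times the row [(-c, 1)]. This row is a left
   eigenvector with eigenvalue [g], so nilpotence of [T] forces [g] into [P]. *)
pose g := - (1 + c * b).
have Pcb : P (1 + c * b).
  rewrite -[_ + _]opprK -/g; apply/PN/(@completely_prime_exp _ n).
  suff [_] : P ((T ^+ n) 1 0 - c * (T ^+ n) 0 0 + g ^+ n * c) /\
     P (g ^+ n - ((T ^+ n) 1 1 - c * (T ^+ n) 0 1)).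
    by rewrite Tn !mxE mulr0 subrr subr0.
  have colE (x1 x2 y1 y2 s t : S) :
      x1 * s + x2 * t - c * (y1 * s + y2 * t) =
      (x1 - c * y1) * s + (x2 - c * y2) * t.
    by rewrite !mulrBl mulrDr opprD addrACA !mulrA.
  elim: (n) => [|k]; first by rewrite !expr0 !mxE /= !mulr0 mulr1 mul1r sub0r addNr
    subr0 subrr.
  rewrite !exprSr -!mulmxE !mulmx2E -/a -/b -/c -/d.
  move: (g ^+ k) (_ 1 0) (_ 1 1) (_ 0 0) (_ 0 1) => gk x1 x2 y1 y2 [IH1 IH2]; split.
    suff -> : x1 * a + x2 * c - c * (y1 * a + y2 * c) + gk * g * c =
      (x1 - c * y1 + gk * c) * a - (gk - (x2 - c * y2)) * c - gk * c * (a + b * c).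
      by apply: PB; [apply: PB; exact: PMr|exact: PMl].
    have -> : gk * g * c = - (gk * c) - gk * c * b * c.
      by rewrite /g mulrN mulrDr mulr1 mulNr mulrDl opprD !mulrA.
    rewrite colE; move: (x1 - c * y1) (x2 - c * y2) => x y.
    rewrite mulrDr !mulrBl mulrDl opprB opprD !mulrA !addrA.
        by rewrite (ACl (1*3*4*2*5*6)) /= addrK.
  suff -> : gk * g - (x1 * b + x2 * d - c * (y1 * b + y2 * d)) =
    (gk - (x2 - c * y2)) * d - (x1 - c * y1 + gk * c) * b - gk * (1 + d).
    by apply: PB; [apply: PB; exact: PMr|exact: PMl].
  rewrite colE /g mulrN !mulrDr mulr1; move: (x1 - c * y1) (x2 - c * y2) => x y.
  rewrite !mulrBl mulrDl !mulrA !opprD !addrA.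
  by rewrite [RHS](ACl (1*6*5*4*3*2)) /= subrr sub0r.
(* Modulo [P], [c (1 - a)] is [c + c b c = (1 + c b) c], hence 0; and [c] in [P] would put 1 in
   [P]. *)
have /PM[Pc|] : P (c * (1 - a)); last by right.
  suff -> : c * (1 - a) = (1 + c * b) * c - c * (a + b * c).
    by apply: PB; [exact: PMr|exact: PMl].
  rewrite mulrDl mul1r mulrBr mulr1 mulrDr mulrA.
  by rewrite [c * a + _]addrC opprD addrA addrK.
by case: P1; rewrite -[1](addrK (c * b)); apply: PB => //; exact: PMr.
Qed.

End NilpotentModPrime.

Lemma mulmx_swap_exp (S : pzRingType) m n (X : 'M[S]_(m, n)) (Y : 'M_(n, m)) k :
  (Y *m X) ^+ k.+1 = Y *m (X *m Y) ^+ k *m X.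
Proof.
elim: k => [|k IH]; first by rewrite expr1 expr0 mulmx1.
by rewrite exprS IH -mulmxE [in RHS]exprS -mulmxE !mulmxA.
Qed.

(* Over a division ring, writing [a E_11 = E + N] forces [E] to have rank at most
   one: [U = 1 + N] is a unit and [E U = E A], so [E = p q] with [p] the first
   column of [E] and [q] the first row of [A U^-1]. Then [A - E = X Y] with
   inner dimension 2, and [Y X] is a nilpotent 2 x 2 matrix. *)
Lemma nil_clean_corner_mod_prime (S : pzRingType) (P : set S) n (a : S) :
  completely_prime_ideal P -> nil_clean_elt (corner_mx n a) -> P a \/ P (1 - a).
Proof.
move=> primeP [E [EE nilN]]; set A := corner_mx n a in nilN.
have [V [UV _]] := nilpotent_add1_unit nilN.
pose q j := a * V 0 j.
have Epq i j : E i j = E i 0 * q j.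
  have EE' : E = E * A * V.
    by rewrite -[E in LHS]mulr1 -UV mulrA mulrDr mulrBr EE mulr1 addrC subrK.
  rewrite [in LHS]EE' mxE (bigD1 0) //= big1 ?addr0 => [|k /negPf k0].
    by rewrite mul_corner_mx mulrA.
  by rewrite mul_corner_mx k0 mul0r.
pose X : 'M[S]_(n.+1, 2) := \matrix_(i,
  j) if j == 0 then (i == 0)%:R * a else E i 0.
pose Y : 'M[S]_(2, n.+1) := \matrix_(i, j) if i == 0 then (j == 0)%:R else - q j.
have XY : X *m Y = A - E.
  apply/matrixP => i j; rewrite mulmx2E !mxE /= mulrN -Epq.
  by case: (i == 0); case: (j == 0); rewrite ?(mul0r, mul1r, mulr0, mulr1).
have [k Nk] := nilN.
have nilT : nilpotent_elt (Y *m X).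
  by exists k.+1; rewrite mulmx_swap_exp XY Nk mulmx0 mul0mx.
have T00 : (Y *m X) 0 0 = a.
  rewrite mxE (bigD1 0) //= big1 => [|i /negPf i0]; rewrite !mxE /= ?i0 ?mul0r //.
  by rewrite !mul1r addr0.
have T01 : (Y *m X) 0 1 = E 0 0.
  rewrite mxE (bigD1 0) //= big1 => [|i /negPf i0]; rewrite !mxE /= ?i0 ?mul0r //.
  by rewrite mul1r addr0.
have T11 : (Y *m X) 1 1 = - \sum_i q i * E i 0.
  by rewrite mxE -sumrN; apply: eq_bigr => i _; rewrite !mxE /= mulNr.
have := nilpotent_mx2_mod_prime primeP nilT; rewrite T00 T01 T11; apply.
have [[P0 _ _] _ _ PM] := primeP.
(* This is entry (0, 0) of [E = E E] rewritten with [Epq]; primality then yields one of the two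
   alternatives required of the 2 x 2 matrix. *)
apply: PM; suff -> : E 0 0 * (1 - \sum_i q i * E i 0) = 0 by [].
rewrite mulrBr mulr1 mulr_sumr; apply/eqP; rewrite subr_eq0; apply/eqP.
rewrite -[in LHS]EE mxE; apply: eq_bigr => i _.
by rewrite mulrA -Epq.
Qed.

Lemma nil_clean_mx_boolean_quot (R : pzRingType) n :
  abelian_ring R -> nil_clean_ring 'M[R]_n.+1 -> boolean_ring (jacobson_quot R).
Proof.
move=> ab nc q; have [x ->] := jacobson_proj_surj q.
apply/eqP; rewrite -rmorphM /= jacobson_proj_eq; apply/jacobsonP => M maxM.
have exch := corner_exchange nc.
have [Ml _ _] := maxM; have [_ _ MM] := Ml.
have Mr := maximal_left_ideal_mulr ab maxM exch.
have primeM : completely_prime_ideal M.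
  split; [by []|exact: Mr|exact: (maximal_left_ideal1 maxM)|].
  exact: (maximal_left_ideal_prime ab maxM exch).
have [Mx|Mx] := nil_clean_corner_mod_prime primeM (nc (corner_mx n x)).
  by rewrite -{3}[x]mul1r -mulrBl; apply: MM.
rewrite -opprB; apply: left_idealN => //.
by rewrite -{1}[x]mulr1 -mulrBr; apply: MM.
Qed.

(** * Maximal left ideals, and matrices over the Jacobson radical *)

Lemma left_ideal_sub_maximal (R : pzRingType) (I : set R) :
  left_ideal I -> ~ I 1 -> exists M, maximal_left_ideal M /\ (I `<=` M)%classic.
Proof.
move=> Il I1; have [I0 ID IM] := Il.
(* Zorn's lemma is applied through unions with [I], so that the empty chain is covered: its union
   joined with [I] is [I] itself. *)
pose P := [set A : set R | left_ideal (I `|` A) /\ ~ (I `|` A) 1]%classic.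
have [F sFP totF|A [[IAl IA1] Amax]] := @Zorn_bigcup R P.
  split; last by move=> [//|[A FA A1]]; have [_] := sFP A FA; apply; right.
  split; first by left.
    move=> x y [Ix|[A FA Ax]] [Iy|[B FB By]].
    - by left; apply: ID.
    - have [[_ D _] _] := sFP B FB.
      by have [|z] := D x y (or_introl Ix) (or_intror By); [left|right; exists B].
    - have [[_ D _] _] := sFP A FA.
      by have [|z] := D x y (or_intror Ax) (or_introl Iy); [left|right; exists A].
    - have [sAB|sBA] := totF A B FA FB.
        have [[_ D _] _] := sFP B FB.
        by have [|z] := D x y (or_intror (sAB x Ax)) (or_intror By); [left|right;
          exists B].
      have [[_ D _] _] := sFP A FA.
      by have [|z] := D x y (or_intror Ax) (or_intror (sBA y By)); [left|right;
        exists A].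
  move=> a x [Ix|[A FA Ax]]; first by left; apply: IM.
  have [[_ _ D] _] := sFP A FA.
  by have [|z] := D a x (or_intror Ax); [left|right; exists A].
exists (I `|` A)%classic; split; last by move=> x; left.
split=> //; first by apply/eqP => IT; apply: IA1; rewrite IT.
move=> J Jl sIAJ JT; apply/seteqP; split=> //; apply: contrapT => nJ.
have IJ : (I `|` J = J)%classic by apply/setUidPr => x Ix; apply: sIAJ; left.
apply: (Amax J); last by split; rewrite IJ //; exact: left_ideal1.
by split=> [x Ax|sJA]; [apply: sIAJ; right|apply: nJ => x /sJA; right].
Qed.

(** Otherwise the left ideal generated by [1 + x] lies in a maximal one, which also contains [x] and
    hence 1. *)
Lemma jacobson_add1_linv (R : pzRingType) (x : R) :
  x \in jacobson R -> exists v, v * (1 + x) = 1.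
Proof.
move=> /jacobsonP Jx; pose I := [set y : R | exists v, y = v * (1 + x)]%classic.
have Il : left_ideal I.
  split; first by exists 0; rewrite mul0r.
    by move=> _ _ [v ->] [w ->]; exists (v + w); rewrite mulrDl.
  by move=> a _ [v ->]; exists (a * v); rewrite mulrA.
apply: contrapT => nI; have [|M [maxM sIM]] := left_ideal_sub_maximal Il.
  by move=> [v /esym vE]; apply: nI; exists v.
apply: (maximal_left_ideal1 maxM); have [[_ MD MM] _ _] := maxM.
rewrite -[1](addrK x); apply: MD; first by apply: sIM; exists 1; rewrite mul1r.
by apply: left_idealN; [case: maxM|exact: Jx].
Qed.

(** Gaussian elimination, by induction on [n]: with [v] a left inverse of the upper left entry, the
    Schur complement [1 + (D - c v r)] is again the identity plus a matrix over the radical. *)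
Lemma jacobson_mx_add1_linv (R : pzRingType) n (B : 'M[R]_n) :
  B \is a mxOver (jacobson R) -> exists V, V *m (1%:M + B) = 1%:M.
Proof.
elim: n B => [|n IH] B JB; first by exists 0; rewrite [LHS]flatmx0 [RHS]flatmx0.
move: B JB; rewrite -[n.+1]/(1 + n)%N => B JB.
have JBij i j : B i j \in jacobson R by exact: (mxOverP JB).
set u := ulsubmx B; set r := ursubmx B; set c := dlsubmx B; set D := drsubmx B.
have [v vE] := jacobson_add1_linv (JBij (lshift n 0) (lshift n 0)).
have vu : v%:M *m (1%:M + u) = 1%:M.
  apply/matrixP => i j; rewrite !ord1 mul_scalar_mx !mxE /=.
  by rewrite vE.
have [|V VE] := IH (D - c *m v%:M *m r).
  apply/mxOverP => i j; rewrite mxE [X in _ + X]mxE; apply: rpredB;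
    first by rewrite !mxE.
  rewrite mxE; apply: rpred_sum => k _; apply: jacobsonMl.
  by rewrite /r !mxE; exact: JBij.
exists (block_mx v%:M (- (v%:M *m r *m V)) 0 V *m block_mx 1%:M 0 (- (c *m v%:M))
  1%:M).
rewrite -[B]submxK -/u -/r -/c -/D [1%:M in X in _ *m X]scalar_mx_block
  add_block_mx.
rewrite -mulmxA mulmx_block !mul1mx !mul0mx !add0r !addr0 mulNmx.
rewrite -[c *m v%:M *m (_ + _)]mulmxA vu mulmx1 addNr mulNmx.
have -> : - (c *m v%:M *m r) + (1%:M + D) = 1%:M + (D - c *m v%:M *m r).
  by rewrite addrC addrA.
by rewrite mulmx_block !mulmx0 !mul0mx !addr0 !add0r vu mulNmx -mulmxA VE mulmx1
  addrN -scalar_mx_block.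
Qed.

(** Write [B = E + N] and let [V] invert [1 + N]. Then [V (1 - E) = 1 - V B] has a left inverse [W],
    so [E = W V (1 - E) E = 0] and [B = N]. *)
Lemma nil_clean_mx_jacobson_nil (R : pzRingType) n :
  nil_clean_ring 'M[R]_n -> nil_subset (mxOver (jacobson R) : {pred 'M[R]_n}).
Proof.
move=> nc B JB; have [E [EE nilN]] := nc B.
suff E0 : E = 0 by rewrite -[B]subr0 -E0.
have [V [UV VU]] := nilpotent_add1_unit nilN.
have [|W WE] := @jacobson_mx_add1_linv R n (- (V *m B)).
  apply/mxOverP => i j; rewrite !mxE rpredN; apply: rpred_sum => k _.
  by apply: jacobsonMl; exact: (mxOverP JB).
have E1 : V * (1 - E) = 1 - V * B.
  have -> : 1 - E = 1 + (B - E) - B by rewrite -addrA [B - E]addrC addrK.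
  by rewrite mulrBr VU.
have {}WE : W * (V * (1 - E)) = 1 by rewrite E1.
rewrite -[LHS]mul1r -WE -!mulrA mulrBl mul1r.
by have -> : E * E = E by []; rewrite subrr !mulr0.
Qed.

(** * Matrices over the field with two elements *)

(** [P] and [Q] are rectangular so that conjugation can pass to a size written as a sum of ranks,
    which equals [n] only by a proof. *)
Lemma nil_clean_conj (S : pzRingType) m n (P : 'M[S]_(m, n)) (Q : 'M_(n, m))
    (A : 'M_n) : P *m Q = 1%:M -> Q *m P = 1%:M ->
  nil_clean_elt (P *m A *m Q) -> nil_clean_elt A.
Proof.
move=> PQ QP [E [EE [k Nk]]]; exists (Q *m E *m P); split.
  rewrite /idempotent_elt -mulmxE -!mulmxA [P *m (Q *m _)]mulmxA PQ mul1mx.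
  by rewrite [E *m (E *m _)]mulmxA [E *m E]EE.
exists k.+1.
have -> : A - Q *m E *m P = Q *m ((P *m A *m Q - E) *m P).
  by rewrite mulmxBl mulmxBr !mulmxA QP mul1mx -[A *m Q *m P]mulmxA QP mulmx1.
suff -> : forall X : 'M_m, (Q *m (X *m P)) ^+ k.+1 = Q *m (X ^+ k.+1 *m P).
  by rewrite exprS Nk mulr0 mul0mx mulmx0.
move=> X; elim: (k) => [//|j IH].
rewrite exprS IH [X ^+ j.+2]exprS -!mulmxE -!mulmxA.
by rewrite [P *m (Q *m _)]mulmxA PQ mul1mx.
Qed.

(** Subtracting the diagonal idempotents leaves a block triangular matrix whose power [k + l] has
    zero diagonal blocks and therefore squares to zero. *)
Lemma nil_clean_block (S : pzRingType) m n (A : 'M[S]_m) (B : 'M_(n,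
  m)) (D : 'M_n) :
  nil_clean_elt A -> nil_clean_elt D -> nil_clean_elt (block_mx A 0 B D).
Proof.
move=> [E [EE [k Nk]]] [F [FF [l Ml]]]; exists (block_mx E 0 0 F); split.
  rewrite /idempotent_elt -mulmxE mulmx_block !mulmx0 !mul0mx !addr0 add0r.
  by rewrite [E *m E]EE [F *m F]FF.
rewrite opp_block_mx add_block_mx !oppr0 !addr0.
set N := A - E in Nk *; set M := D - F in Ml *.
have powE j : exists C, block_mx N 0 B M ^+ j = block_mx (N ^+ j) 0 C (M ^+ j).
  elim: j => [|j [C IH]]; first by exists 0; rewrite !expr0 -scalar_mx_block.
  exists (B *m N ^+ j + M *m C); rewrite exprS IH -mulmxE mulmx_block.
  by rewrite !mulmx0 !mul0mx !addr0 add0r !mulmxE -!exprS.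
have [C CE] := powE (k + l)%N.
exists ((k + l) * 2)%N; rewrite exprM CE !exprD Nk Ml mul0r mulr0.
by rewrite expr2 -mulmxE mulmx_block !mulmx0 !mul0mx !addr0 block_mx0.
Qed.

Section TwoElementField.
Variable F : fieldType.
Hypothesis F_cases : forall x : F, x = 0 \/ x = 1.

Lemma nil_clean_scalar_F2 n (x : F) : nil_clean_elt (x%:M : 'M_n).
Proof.
exists x%:M; split; last by exists 1%N; rewrite subrr.
rewrite /idempotent_elt -mulmxE -scalar_mxM.
by case: (F_cases x) => ->; rewrite ?mul0r ?mul1r.
Qed.

(** In a basis adapted to the invariant row space of [U] and a complement, [A] is block lower
    triangular with smaller diagonal blocks. *)
Lemma nil_clean_stable_F2 n (A U : 'M[F]_n) :
  (U *m A <= U)%MS -> (0 < \rank U < n)%N ->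
  (forall m, (m < n)%N -> nil_clean_ring 'M[F]_m) -> nil_clean_elt A.
Proof.
move=> UA /andP[U0 Un] IH.
set W := row_base U; set W' := row_base (U^C)%MS.
pose P := col_mx W W'.
have Prank : \rank P = n.
  rewrite -addsmxE (adds_eqmx (eq_row_base U) (eq_row_base _)).
  exact/eqP/addsmx_compl_full.
have Pfull : row_full P by rewrite /row_full Prank.
have Pfree : row_free P.
  by rewrite /row_free Prank mxrank_compl subnKC // ltnW.
have [Q PQ] := row_freeP Pfree; have [Q' Q'P] := row_fullP Pfull.
have QP : Q *m P = 1%:M.
  by rewrite -[Q in LHS]mul1mx -Q'P -(mulmxA Q') PQ mulmx1.
apply: (nil_clean_conj PQ QP).
have [C WA] : exists C, W *m A = C *m W.
  apply/submxP; rewrite (eqmxMr _ (eq_row_base U)).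
  by apply: submx_trans UA _; rewrite eq_row_base.
have -> : P *m A *m Q = block_mx C 0 (lsubmx (W' *m A *m Q)) (rsubmx (W' *m A *m
  Q)).
  rewrite block_mxEv hsubmxK mul_col_mx mul_col_mx; congr col_mx.
  suff -> : W *m A = row_mx C 0 *m P by rewrite -mulmxA PQ mulmx1.
  by rewrite mul_row_col mul0mx addr0.
by apply: nil_clean_block; apply: IH => //;
  rewrite mxrank_compl ltn_subrL U0 (leq_ltn_trans _ Un).
Qed.

Lemma shift_mx_nilpotent (S : pzRingType) n :
  nilpotent_elt (\matrix_(i < n, j < n) (j == i.+1 :> nat)%:R : 'M[S]_n).
Proof.
set N := \matrix_(i, j) _; exists n.
suff powE k i j : (N ^+ k) i j = (j == i + k :> nat)%N%:R.
  apply/matrixP => i j; rewrite powE mxE; case: eqP => // jE.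
  by have := ltn_ord j; rewrite jE ltnNge leq_addl.
elim: k i j => [|k IH] i j; first by rewrite mxE addn0 eq_sym.
rewrite exprS mxE; have [ltin|leni] := ltnP i.+1 n.
  rewrite (bigD1 (Ordinal ltin)) //= big1 => [|l li].
    by rewrite mxE eqxx mul1r addr0 IH addSnnS.
  by rewrite mxE; case: eqP => [lE|_]; [case/eqP: li; apply: val_inj|rewrite mul0r].
rewrite big1 => [|l _].
  by case: eqP => // jE; have := ltn_ord j;
    rewrite jE addnS -addSn ltnNge (leq_trans leni) ?leq_addr.
by rewrite mxE; case: eqP => [lE|_]; [have := ltn_ord l;
  rewrite lE ltnNge leni|rewrite mul0r].
Qed.

(** The idempotent is [C] minus the shift, which keeps only the diagonal entry [c] in row 1 and the
    last row. Multiplication by it fixes the last row because that row ends in 1 and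
    [C ord_max 1 * c = 0]. For [m = 0], row 1 is itself the last row, hence the guard. *)
Lemma nil_clean_hessenberg_F2 m (c : F) (C : 'M[F]_m.+2) :
  (forall i j : 'I_m.+2, (i < m.+1)%N ->
     C i j = (j == i.+1 :> nat)%:R + ((i == 1) && (j == 1))%:R * c) ->
  C ord_max ord_max = 1 -> ((0 < m)%N -> C ord_max 1 * c = 0) ->
  nil_clean_elt C.
Proof.
move=> CE Cmax C1; set N : 'M[F]_m.+2 := \matrix_(i, j) (j == i.+1 :> nat)%:R.
exists (C - N); split; last by rewrite subKr; exact: shift_mx_nilpotent.
have EE (i j : 'I_m.+2) : (i < m.+1)%N -> (C - N) i j = ((i == 1) && (j == 1))%:R *
  c.
  by move=> ltim; rewrite !mxE CE // addrC addKr.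
have Emax j : (C - N) ord_max j = C ord_max j.
  rewrite !mxE; case: eqP => [jE|_]; last by rewrite subr0.
  by have := ltn_ord j; rewrite jE ltnn.
have cc : c * c = c by case: (F_cases c) => ->; rewrite ?mul0r ?mul1r.
move: (C - N) EE Emax => E EE Emax.
rewrite /idempotent_elt; apply/matrixP => i j; rewrite mxE.
have [ltim|leim] := ltnP i m.+1.
  rewrite [RHS]EE //; have [i1|i1] := eqVneq i 1; last first.
    by rewrite /= mul0r big1 // => k _; rewrite EE // (negPf i1) !mul0r.
  rewrite (bigD1 1) //= big1 => [|k /negPf k1];
    last by rewrite EE // k1 andbF !mul0r.
  rewrite EE // i1 !eqxx /= mul1r addr0 EE -?i1 // i1 eqxx /=.
  by rewrite mulrCA cc.
have -> : i = ord_max by apply/val_inj/anti_leq; rewrite leim -ltnS ltn_ord.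
rewrite (bigD1 ord_max) //= big1 => [|k kmax];
  first by rewrite !Emax Cmax mul1r addr0.
have ltkm : (k < m.+1)%N.
  by rewrite ltn_neqAle -ltnS ltn_ord andbT; apply: contra kmax => /eqP kE;
    apply/eqP/val_inj.
rewrite [E k j]EE // Emax; case: eqP => [k1|_]; last by rewrite /= mul0r mulr0.
rewrite k1 mulrCA C1 ?mulr0 //.
by move: ltkm; rewrite k1.
Qed.

Lemma exp_char_poly_F2 m (A : 'M[F]_m.+1) :
  exists a : 'I_m.+1 -> F, A ^+ m.+1 = \sum_i a i *: A ^+ i.
Proof.
exists (fun i => - (char_poly A)`_i).
have := Cayley_Hamilton A;
  rewrite -[X in horner_mx _ X]coefK size_char_poly poly_def.
rewrite rmorph_sum /= big_ord_recr /= => /eqP.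
have hE i (a : F) : horner_mx A (a *: 'X^i) = a *: A ^+ i.
  by rewrite linearZ /= rmorphXn /= horner_mx_X.
have -> : (char_poly A)`_m.+1 = 1.
  by have /eqP := char_poly_monic A; rewrite lead_coefE size_char_poly.
rewrite hE scale1r addrC addr_eq0 => /eqP ->.
by rewrite -sumrN; apply: eq_bigr => i _; rewrite hE scaleNr.
Qed.

(** The kernel of [A - x%:M] is stable under [A]; were it nonzero, it would be the whole space. *)
Lemma stable_unit_F2 m (A : 'M[F]_m) (x : F) :
  (forall U : 'M_m, (U *m A <= U)%MS -> U != 0 -> row_full U) ->
  A != x%:M -> A - x%:M \in unitmx.
Proof.
move=> irrA Ax; rewrite -row_free_unit -kermx_eq0; apply: contraNT Ax => K0.
have KA : (kermx (A - x%:M) *m A <= kermx (A - x%:M))%MS.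
  apply/sub_kermxP; rewrite -mulmxA.
  have -> : A *m (A - x%:M) = (A - x%:M) *m A.
    by rewrite mulmxBl mulmxBr scalar_mxC.
  by rewrite mulmxA mulmx_ker mul0mx.
have /row_fullP [Q QK] := irrA _ KA K0.
by rewrite -subr_eq0 -[_ - _]mul1mx -QK -mulmxA mulmx_ker mulmx0.
Qed.

(* In the basis [v, v A, v A (A - c), v A^2 (A - c), ...] of a cyclic space, the
   matrix is a companion matrix with one more diagonal entry [c]; the scalar [c]
   makes the last diagonal entry equal to [1]. *)
Lemma nil_clean_irreducible_F2 m (A : 'M[F]_m.+2) :
  (forall U : 'M_m.+2, (U *m A <= U)%MS -> U != 0 -> row_full U) ->
  nil_clean_elt A.
Proof.
move=> irrA; have [[x ->]|Anscal] := pselect (exists x, A = x%:M).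
  exact: nil_clean_scalar_F2.
have Aunit x : A - x%:M \in unitmx by apply: stable_unit_F2 => //; apply/eqP => Ax;
  apply: Anscal; exists x.
pose v : 'rV[F]_m.+2 := delta_mx 0 0.
pose U : 'M_m.+2 := \matrix_(i < m.+2) (v *m A ^+ i).
have Ufull : row_full U.
  apply: irrA; last first.
    apply/eqP => /row_matrixP/(_ 0); rewrite rowK row0 mulmx1 => /matrixP/(_ 0 0).
    by rewrite !mxE /= => /eqP; rewrite oner_eq0.
  apply/row_subP => i; rewrite row_mul rowK -mulmxA mulmxE -exprSr.
  have [lti|lei] := ltnP i.+1 m.+2.
    by apply: (eq_row_sub (Ordinal lti)); rewrite rowK.
  have -> : i.+1 = m.+2 by apply/anti_leq; rewrite lei ltn_ord.
  have [a ->] := exp_char_poly_F2 A; rewrite mulmx_sumr summx_sub // => j _.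
  by rewrite -scalemxAr scalemx_sub //; apply: (eq_row_sub j); rewrite rowK.
(* For positive [m] the last diagonal entry of the new matrix is [\tr A - c], that is -1, which is 1
   in a field with two elements. *)
pose c := \tr A + 1.
pose w i := v *m A ^+ i - (if (1 < i)%N then c *: (v *m A ^+ i.-1) else 0).
pose K : 'M_m.+2 := \matrix_(i < m.+2) w i.
have UK : (U <= K)%MS.
  suff UK k (ltk : (k < m.+2)%N) : (v *m A ^+ k <= K)%MS.
    by apply/row_subP => i; rewrite rowK UK.
  elim: k ltk => [|k IH] ltk.
    by apply: (eq_row_sub (Ordinal ltk)); rewrite rowK /w subr0.
  rewrite -[v *m _](subrK (if (1 < k.+1)%N then c *: (v *m A ^+ k) else 0)).
  apply: addmx_sub; first by apply: (eq_row_sub (Ordinal ltk)); rewrite rowK.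
  by case: ifP => _; rewrite ?sub0mx // scalemx_sub // IH // ltnW.
have Kunit : K \in unitmx.
  by rewrite -row_full_unit -sub1mx (submx_trans _ UK) // sub1mx.
apply: (nil_clean_conj (mulmxV Kunit) (mulVmx Kunit)).
set C := K *m A *m invmx K.
have wA i : w i *m A = w i.+1 + (if i == 1%N then c *: w i else 0).
  have wE k : (v *m A ^+ k) *m A = v *m A ^+ k.+1 by rewrite -mulmxA mulmxE -exprSr.
  rewrite /w mulmxBl wE; case: i => [|[|i]] /=.
  - by rewrite mul0mx addr0.
  - by rewrite mul0mx !subr0 subrK.
  - by rewrite -scalemxAl wE addr0.
have wK (k : 'I_m.+2) : w k *m invmx K = delta_mx 0 k.
  by rewrite -row1 -(mulmxV Kunit) row_mul rowK.
have CE (i j : 'I_m.+2) : (i < m.+1)%N ->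
    C i j = (j == i.+1 :> nat)%:R + ((i == 1) && (j == 1))%:R * c.
  move=> lti.
  have rowC : row i C = delta_mx 0 (Ordinal (lti : i.+1 < m.+2)%N) +
      (if i == 1 then c *: delta_mx 0 i else 0).
    rewrite /C !row_mul rowK wA mulmxDl (wK (Ordinal (lti : i.+1 < m.+2)%N)).
    congr (_ + _); have -> : (i == 1%N :> nat) = (i == 1) by [].
    by case: ifP => _; rewrite ?mul0mx // -scalemxAl wK.
  have -> : C i j = (row i C) 0 j by rewrite [RHS]mxE.
  rewrite rowC mxE [delta_mx _ _ _ _]mxE eqxx; congr (_ + _).
  by case: eqP => [->|_]; rewrite /= !mxE ?eqxx ?mul0r //= mulrC.
have trC : \tr C = \tr A by rewrite /C mxtrace_mulC mulmxA mulVmx // mul1mx.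
have Cunit x : C - x%:M \in unitmx.
  have -> : C - x%:M = K *m (A - x%:M) *m invmx K.
    by rewrite mulmxBr mulmxBl scalar_mxC -(mulmxA _ K) mulmxV // mulmx1.
  by rewrite !unitmx_mul Kunit Aunit unitmx_inv Kunit.
clearbody C.
have ker0 x (u : 'cV_m.+2) : (C - x%:M) *m u = 0 -> u = 0.
  by move=> Cu; rewrite -[u](mulKmx (Cunit x)) Cu mulmx0.
(* Otherwise the first column of [C] vanishes, although [C] is invertible. *)
have l0 : C ord_max 0 = 1.
  have [C0|//] := F_cases (C ord_max 0).
  have /(ker0 0)/matrixP/(_ 0 0) : (C - 0%:M) *m (delta_mx 0 0 : 'cV_m.+2) = 0.
    rewrite raddf0 subr0 -colE; apply/colP => i; rewrite !mxE.
    have [lti|lei] := ltnP i m.+1; first by rewrite CE // andbF mul0r addr0.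
    by have -> : i = ord_max by apply/val_inj/anti_leq; rewrite lei -ltnS ltn_ord.
  by rewrite !mxE /= => /eqP; rewrite oner_eq0.
(* Equality would make the column with ones at indices 0 and 1 a fixed vector of [C], while [C - 1]
   is invertible. The right side is the last entry of that column, nonzero only for [m = 0]. *)
have l01 : c = 1 -> C ord_max 0 + C ord_max 1 != (m == 0)%:R.
  move=> c1; apply/eqP => lE.
  pose u : 'cV[F]_m.+2 := \col_i (i < 2)%N%:R.
  have /(ker0 1)/matrixP/(_ 0 0) : (C - 1%:M) *m u = 0;
    last by rewrite !mxE => /eqP; rewrite oner_eq0.
  apply/eqP; rewrite mulmxBl mul1mx subr_eq0; apply/eqP/colP => i.
  rewrite mxE (bigD1 0) //= (bigD1 1) //= big1 => [|j /andP[j0 j1]]; last first.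
    rewrite !mxE; have : (1 < j)%N by move: j0 j1; case: j => [[|[|]]].
    by rewrite ltnNge -ltnS => /negPf ->; rewrite mulr0.
  rewrite !mxE !mulr1 addr0.
  have [lti|lei] := ltnP i m.+1.
    rewrite !CE // c1 andbF andbT mul0r add0r add0r mulr1.
    by case: i lti => [[|[|i]] ? ?] /=; rewrite ?addr0 ?add0r.
  have -> : i = ord_max by apply/val_inj/anti_leq; rewrite lei -ltnS ltn_ord.
  by rewrite lE; case: (m).
have trE : \tr C = (0 < m)%N%:R * c + C ord_max ord_max.
  rewrite /mxtrace big_ord_recr /=; congr (_ + _).
  rewrite (eq_bigr (fun i : 'I_m.+1 => if i == 1%N :> nat then c else 0));
    last first.
    move=> i _; rewrite CE //= ltn_eqF // add0r andbb.
    by have -> : (widen_ord (leqnSn m.+1) i == 1) = (i == 1%N :> nat) by [];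
      case: ifP; rewrite ?mul0r ?mul1r.
  case: (m) => [|m']; first by rewrite big_ord1 mul0r.
  rewrite (bigD1 1) //= big1 ?mul1r ?addr0 // => i i1.
  by case: eqP => // i1'; case/eqP: i1; apply: val_inj.
have [c0|c1] := F_cases c.
  have trA : \tr A = 1.
    by have [t0|//] := F_cases (\tr A); move: c0; rewrite /c t0 add0r.
  apply: (nil_clean_hessenberg_F2 CE) => [|_]; last by rewrite c0 mulr0.
  by rewrite -trA -trC trE c0 mulr0 add0r.
have trA : \tr A = 0 by apply: (addIr 1); rewrite add0r.
(* For [m = 0], index 1 is [ord_max] and [l1] makes the last diagonal entry 1. For positive [m] it
   gives [C ord_max 1 = 0], as [nil_clean_hessenberg_F2] demands. *)
have := l01 c1; rewrite l0 => l1.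
have F11 : 1 + 1 = 0 :> F.
  by have [//|/eqP] := F_cases (1 + 1); rewrite -subr_eq0 addrK oner_eq0.
apply: (nil_clean_hessenberg_F2 CE).
  have [m0|m0] := posnP m.
    have maxE : ord_max = 1 :> 'I_m.+2 by apply: val_inj; rewrite /= m0.
    rewrite maxE in l1 *; have [C0|//] := F_cases (C 1 1).
    by move: l1; rewrite C0 addr0 m0 eqxx.
  have [Cmax0|//] := F_cases (C ord_max ord_max).
  by move: trE; rewrite trC trA m0 c1 mul1r Cmax0 addr0 => /esym/eqP;
    rewrite oner_eq0.
move=> m0; have [->|C1] := F_cases (C ord_max 1); first by rewrite mul0r.
by move: l1; rewrite C1 F11 gtn_eqF // eqxx.
Qed.

Lemma nil_clean_mx_F2 n : nil_clean_ring 'M[F]_n.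
Proof.
elim/ltn_ind: n => n IH A.
have [[U [UA rkU]]|noU] := pselect (exists U : 'M_n,
  (U *m A <= U)%MS /\ (0 < \rank U < n)%N).
  exact: nil_clean_stable_F2 UA rkU IH.
have irrA (U : 'M_n) : (U *m A <= U)%MS -> U != 0 -> row_full U.
  move=> UA U0; rewrite /row_full eqn_leq rank_leq_col /= leqNgt.
  by apply/negP => ltUn; apply: noU; exists U; rewrite UA ltUn lt0n mxrank_eq0 U0.
case: n A {IH noU} irrA => [|[|n]] A irrA.
- by rewrite [A]flatmx0 -(raddf0 (@scalar_mx F 0)); exact: nil_clean_scalar_F2.
- by rewrite [A]mx11_scalar; exact: nil_clean_scalar_F2.
- exact: nil_clean_irreducible_F2.
Qed.

End TwoElementField.

(** * Boolean rings and lifting of idempotents *)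

Lemma boolean_ring_addxx (B : pzRingType) : boolean_ring B -> forall x : B,
  x + x = 0.
Proof.
move=> hB x; have : (x + x) * (x + x) = x + x by exact: hB.
rewrite mulrDl mulrDr [x * x]hB => /eqP.
by rewrite -subr_eq0 addrK => /eqP.
Qed.

Lemma boolean_ring_comm (B : pzRingType) : boolean_ring B -> commutative
  (@GRing.mul B).
Proof.
move=> hB x y; have : (x + y) * (x + y) = x + y by exact: hB.
rewrite mulrDl !mulrDr [x * x]hB [y * y]hB [y * x + y]addrC addrACA -[RHS]addr0.
by move=> /addrI xyx; apply: (addIr (y * x)); rewrite xyx boolean_ring_addxx.
Qed.

Lemma exprD_orthogonal (S : pzRingType) (x y : S) k :
  x * y = 0 -> y * x = 0 -> (x + y) ^+ k.+1 = x ^+ k.+1 + y ^+ k.+1.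
Proof.
move=> xy yx; elim: k => [//|k IH]; rewrite exprS IH mulrDl !mulrDr.
have -> : x * y ^+ k.+1 = 0 by rewrite exprS mulrA xy mul0r.
have -> : y * x ^+ k.+1 = 0 by rewrite exprS mulrA yx mul0r.
by rewrite addr0 add0r -!exprS.
Qed.

Section BooleanMatrices.
Variable B : comPzRingType.
Hypothesis hB : boolean_ring B.

Lemma scalemx_exp_idem n (h : B) (X : 'M[B]_n) k : (h *: X) ^+ k.+1 = h *: X ^+
  k.+1.
Proof.
elim: k => [//|k IH]; rewrite exprS IH [X ^+ k.+2]exprS -[h *: X * _]/(h *: X *m _).
by rewrite -scalemxAl -scalemxAr scalerA [h * h]hB.
Qed.

Lemma mul_orthogonal_scalemx n (h g : B) (X Y : 'M[B]_n) :
  h * g = 0 -> h *: X = X -> g *: Y = Y -> X * Y = 0.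
Proof.
move=> hg <- <-.
by rewrite -mulmxE -scalemxAl -scalemxAr scalerA hg scale0r.
Qed.

(** This is nil-cleanness of [h *: A] in the corner ring with identity [h], expressed inside the
    full matrix ring. *)
Definition nil_clean_part n (A : 'M[B]_n) (h : B) : Prop :=
  exists E : 'M[B]_n, [/\ idempotent_elt E,
    h *: E = E & nilpotent_elt (h *: A - E)].

(** [h a] and [h (1 - a)] are orthogonal idempotents with sum [h], so the idempotents and the
    nilpotents of the two parts can be added. *)
Lemma nil_clean_part_split n (A : 'M[B]_n) (h a : B) :
  nil_clean_part A (h * a) -> nil_clean_part A (h * (1 - a)) -> nil_clean_part A h.
Proof.
move=> [E [EE hE [k Nk]]] [F [FF hF [l Nl]]].
have aa : a * (1 - a) = 0 by rewrite mulrBr mulr1 [a * a]hB subrr.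
have o1 : h * a * (h * (1 - a)) = 0 by rewrite mulrACA aa mulr0.
have o2 : h * (1 - a) * (h * a) = 0 by rewrite mulrC.
have hD : h = h * a + h * (1 - a) by rewrite -mulrDr addrC subrK mulr1.
exists (E + F); split.
- rewrite /idempotent_elt mulrDl !mulrDr [E * E]EE [F * F]FF.
  by rewrite (mul_orthogonal_scalemx o1) // (mul_orthogonal_scalemx o2) // addr0
    add0r.
- by rewrite scalerDr -hE -hF !scalerA !mulrA [h * h]hB.
have -> : h *: A - (E + F) = (h * a *: A - E) + (h * (1 - a) *: A - F).
  by rewrite {1}hD scalerDl opprD addrACA.
exists (k + l).+1.
have idem (g : B) (X Y : 'M[B]_n) : g *: Y = Y -> g *: (g *: X - Y) = g *: X - Y.
  by move=> gY; rewrite scalerBr scalerA [g * g]hB gY.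
rewrite exprD_orthogonal.
- by rewrite -addSn exprD exprSr Nk mul0r mul0r add0r addSnnS exprD exprSr Nl mul0r
  mulr0.
- by apply: (mul_orthogonal_scalemx o1); exact: idem.
- by apply: (mul_orthogonal_scalemx o2); exact: idem.
Qed.

Definition F2_embed (x : 'F_2) : B := (x : nat)%:R.

Lemma F2_cases (x : 'F_2) : x = 0 \/ x = 1.
Proof. by case: x => [[|[|//]] ?]; [left|right]; apply: val_inj. Qed.

Lemma F2_embed_zmod_morphism : zmod_morphism F2_embed.
Proof.
have B2 : 1 + 1 = 0 :> B by exact: boolean_ring_addxx.
move=> x y; case: (F2_cases x) => ->; case: (F2_cases y) => ->;
  rewrite /F2_embed /= ?subrr ?subr0 //.
by apply/eqP; rewrite sub0r -addr_eq0 B2.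
Qed.

Lemma F2_embed_monoid_morphism : monoid_morphism F2_embed.
Proof.
by split=> // x y; case: (F2_cases x) => ->; case: (F2_cases y) => ->;
  rewrite /F2_embed /= ?mul0r ?mulr0 ?mulr1.
Qed.

HB.instance Definition _ :=
  GRing.isZmodMorphism.Build 'F_2 B F2_embed F2_embed_zmod_morphism.
HB.instance Definition _ :=
  GRing.isMonoidMorphism.Build 'F_2 B F2_embed F2_embed_monoid_morphism.

Lemma nil_clean_part_F2 n (A : 'M[B]_n) (h : B) :
  (forall i j, h * A i j = 0 \/ h * A i j = h) -> nil_clean_part A h.
Proof.
(* [A0] marks the nonzero entries of [h *: A], all equal to [h]. Its decomposition over the
   two-element field is carried to [B] and multiplied by [h]. *)
move=> hA; pose A0 : 'M['F_2]_n := \matrix_(i, j) (h * A i j != 0)%:R.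
have [E [EE [k Nk]]] := nil_clean_mx_F2 F2_cases A0.
have hAE : h *: A = h *: map_mx F2_embed A0.
  apply/matrixP => i j; rewrite !mxE; have [->|hAij] := eqVneq (h * A i j) 0.
    by rewrite rmorph0 mulr0.
  by case: (hA i j) hAij => [->|-> _]; rewrite ?eqxx // rmorph1 mulr1.
exists (h *: map_mx F2_embed E); split.
- rewrite /idempotent_elt -[_ * _]/(_ *m _) -scalemxAl -scalemxAr scalerA [h * h]hB.
  by rewrite -map_mxM -[E *m E]/(E * E) EE.
- by rewrite scalerA [h * h]hB.
exists k.+1; rewrite hAE -scalerBr -map_mxB scalemx_exp_idem.
have -> j : map_mx F2_embed (A0 - E) ^+ j = map_mx F2_embed ((A0 - E) ^+ j).
  elim: j => [|j IH]; first by rewrite !expr0 [RHS]map_mx1.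
  by rewrite exprS IH [in RHS]exprS -[_ * _]/(_ *m _) -map_mxM.
by rewrite exprS Nk mulr0 map_mx0 scaler0.
Qed.

Lemma nil_clean_mx_boolean_com n : nil_clean_ring 'M[B]_n.
Proof.
move=> A.
suff [E [EE _ nilN]] : nil_clean_part A 1 by exists E; split;
  rewrite // -[A]scale1r.
(* The list [s] holds the positions where [h * A i j] is not yet known to be 0 or [h]. Splitting [h]
   by [a = A k l] settles one of them: the entry becomes [h a] on the first part and 0 on the
   second. *)
suff part (s : seq ('I_n * 'I_n)) h :
    (forall i j, (i, j) \notin s -> h * A i j = 0 \/ h * A i j = h) ->
      nil_clean_part A h.
  by apply: (part (enum {: 'I_n * 'I_n})) => i j; rewrite mem_enum.
elim: s h => [|[k l] s IH] h hs; first by apply: nil_clean_part_F2 => i j;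
  exact: hs.
apply: (@nil_clean_part_split _ _ _ (A k l)); apply: IH => i j ijs.
- have [[-> ->]|ijkl] := eqVneq (i, j) (k, l).
    by right; rewrite -mulrA [A k l * _]hB.
  rewrite mulrAC; case: (hs i j) => [|->|->];
    rewrite ?mul0r ?inE ?negb_or ?ijkl //; by [left|right].
- have [[-> ->]|ijkl] := eqVneq (i, j) (k, l).
    by left; rewrite -mulrA mulrBl mul1r [A k l * _]hB subrr mulr0.
  rewrite mulrAC; case: (hs i j) => [|->|->];
    rewrite ?mul0r ?inE ?negb_or ?ijkl //; by [left|right].
Qed.

End BooleanMatrices.

Lemma nil_clean_mx_boolean (B : pzRingType) n : boolean_ring B -> nil_clean_ring
  'M[B]_n.
Proof.
(* [C] has the operations of [B], so the matrix rings over both agree by conversion. *)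
move=> hB; pose C : comPzRingType :=
  HB.pack (GRing.PzRing.sort B) (GRing.PzRing.class B)
    (GRing.PzRing_hasCommutativeMul.Build B (boolean_ring_comm hB)).
exact: (@nil_clean_mx_boolean_com C hB).
Qed.

(* Newton's iteration [x |-> 3 x^2 - 2 x^3 = x + y z], with [y = x^2 - x] and
   [z = 1 - 2 x], squares the defect: [z^2 = 1 + 4 y] turns [y] into
   [y^2 (z^2 - 4)]. *)
Lemma idempotent_lift (S : pzRingType) (x : S) : nilpotent_elt (x * x - x) ->
  exists e t, idempotent_elt e /\ e = x + (x * x - x) * t.
Proof.
move=> [k]; elim/ltn_ind: k x => k IH x; set y := x * x - x => yk.
have [k1|k1] := leqP k 1.
  exists x, 0; rewrite mulr0 addr0; split=> //; apply/eqP; rewrite -subr_eq0 -/y.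
  by case: k k1 yk {IH} => [|[|//]] _; rewrite ?expr1 ?expr0 => yk;
    rewrite ?yk // -[y]mul1r yk mul0r.
pose z := 1 - x *+ 2.
have xy : GRing.comm x y by apply: commrB => //; exact: commrM.
have xz : GRing.comm x z by apply: commrB; [exact: commr1|exact: commrMn].
have yz : GRing.comm y z by apply/commrB; [exact: commr1|exact/commrMn/commr_sym].
have zzE : z * z = 1 + y * 4%:R.
  rewrite mulr_natr /z mulrBl mul1r mulrBr mulr1 opprB mulrnAl mulrnAr -mulrnA.
  rewrite mulrnBl -addrA; congr (1 + _).
  by rewrite addrCA -opprD -mulrnDr.
pose w := z * z - 4%:R.
have yw : GRing.comm y w by apply: commrB; [exact: commrM|exact: commr_nat].
have zE : x *+ 2 = 1 - z by rewrite subKr.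
have yE : x * x = x + y by rewrite addrC subrK.
have wE : y * w = y * (z * z) - y * 4%:R by rewrite mulrBr.
clearbody w z y.
pose x' := x + y * z.
have y'E : x' * x' - x' = y * (y * w).
  have -> : x' * x' = x * x + (y * z - y * (z * z)) + y * (y * (z * z)).
    rewrite mulrDl !mulrDr -addrA -[RHS]addrA; congr (_ + _).
    rewrite addrA; congr (_ + _).
      rewrite mulrA xy -!mulrA xz -mulrDr -mulrDr -mulr2n.
      by rewrite zE mulrBr mulr1 mulrBr.
    by rewrite -!mulrA (mulrA z y) -yz -mulrA.
  rewrite yE /x' wE mulrBr opprD addrA.
  have -> : y * (z * z) = y + y * (y * 4%:R) by rewrite zzE mulrDr mulr1.
  rewrite opprD !addrA (ACl (6*5*1*7*2*4*3*8)) /=.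
  by rewrite !addrK.
have k0 : (0 < k)%N by exact: ltnW.
have ltk : (k.-1 < k)%N by rewrite prednK.
(* The power [k - 1] of the new defect [y (y w)] contains [y] to the power [2k - 2], which is at
   least [k] since [k >= 2]. *)
have [|e [t [ee eE]]] := IH k.-1 ltk x'.
  rewrite y'E exprMn_comm; last exact: commrM.
  rewrite exprMn_comm // mulrA -exprD.
  have -> : (k.-1 + k.-1 = k + (k - 2))%N.
    by case: (k) k1 => [|[|m]] // _; rewrite !subSS subn0 /= addnS !addSn.
  by rewrite exprD yk !mul0r.
exists e, (z + y * w * t); split=> //.
by rewrite eE y'E mulrDr !mulrA addrA.
Qed.

(** The lifted idempotent [e] still maps to [e'], because it differs from [x] by a multiple of
    [x * x - x]. A power of [a - e] then falls into the nil kernel. *)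
Lemma nil_clean_lift (S T : pzRingType) (f : {rmorphism S -> T}) :
  (forall y, exists x, y = f x) -> (forall x, f x = 0 -> nilpotent_elt x) ->
  nil_clean_ring T -> nil_clean_ring S.
Proof.
move=> fsurj fker nc a; have [e' [ee' [k Nk]]] := nc (f a).
have [x xE] := fsurj e'.
have fx0 : f (x * x - x) = 0.
  by rewrite rmorphB rmorphM -xE ee' subrr.
have [e [t [ee eE]]] := idempotent_lift (fker _ fx0).
exists e; split=> //.
have fe : f e = e' by rewrite eE rmorphD rmorphM fx0 mul0r addr0.
have [|l Nl] := fker ((a - e) ^+ k); first by rewrite rmorphXn rmorphB fe.
by exists (k * l)%N; rewrite exprM.
Qed.

Lemma nil_clean_mx_boolean_quot_nil (R : pzRingType) n :
  boolean_ring (jacobson_quot R) ->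
  nil_subset (mxOver (jacobson R) : {pred 'M[R]_n}) -> nil_clean_ring 'M[R]_n.
Proof.
move=> hB nilJ.
pose f := map_mx (jacobson_proj (R := R)) : 'M[R]_n -> 'M[jacobson_quot R]_n.
have fB : zmod_morphism f by move=> A B; exact: map_mxB.
have fM : monoid_morphism f by split=> [|A B]; [exact: map_mx1|exact: map_mxM].
pose g : {rmorphism 'M[R]_n -> 'M[jacobson_quot R]_n} :=
  HB.pack f (GRing.isZmodMorphism.Build _ _ f fB)
    (GRing.isMonoidMorphism.Build _ _ f fM).
apply: (@nil_clean_lift _ _ g); last exact: nil_clean_mx_boolean.
- move=> A; exists (map_mx repr A); apply/matrixP => i j; rewrite !mxE.
  by rewrite /jacobson_proj reprK.
- move=> A /matrixP A0; apply: nilJ; apply/mxOverP => i j.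
  by rewrite -jacobson_proj_eq0; have := A0 i j; rewrite !mxE => ->.
Qed.

Theorem theorem2p7 (R : pzRingType) (n : nat) :
  abelian_ring R -> (0 < n)%N ->
  (nil_clean_ring 'M[R]_n <->
   boolean_ring (jacobson_quot R) /\
   nil_subset (mxOver (jacobson R) : {pred 'M[R]_n})).
Proof.
case: n => // n ab _; split=> [nc|[hB nilJ]].
  by split; [exact: nil_clean_mx_boolean_quot nc|exact: nil_clean_mx_jacobson_nil].
exact: nil_clean_mx_boolean_quot_nil.
Qed.
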